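(* Let $p$ be an odd prime and let $G$ be a group of order $p^5$ which is not $p$-central and such that $|\Phi(G)|=p^2$. Then the transiso graph $\Gamma_p(G)$ is not complete unless $\Phi(G)=G'=Z(G)\cong C_p\times C_p$; that is, if $\Gamma_p(G)$ is complete, then $\Phi(G)=G'=Z(G)\cong C_p\times C_p$.
   Context: $\Phi(G)$, $G'$, $Z(G)$ and $C_p$ denote the Frattini subgroup, the commutator subgroup, the center of $G$, and the cyclic group of order $p$, respectively. A finite $p$-group is not $p$-central if it has a subgroup of order $p$ not contained in its center. For a finite group $G$ and a subgroup $H\le G$, a normalized right transversal (NRT) of $H$ in $G$ is a subset $S\subseteq G$ with $1\in S$ containing exactly one element of each right coset of $H$ in $G$; $\mathcal{T}(G,H)$ denotes the set of all NRTs of $H$ in $G$. An NRT $S$ carries the induced binary operation $\circ$ defined by $\{x\circ y\}=S\cap Hxy$ for $x,y\in S$, which makes $S$ a right loop with identity $1$. Two NRTs $S,T$ (possibly of different subgroups) are isomorphic, $S\cong T$, if there is a bijection $S\to T$ preserving the induced operations. For a divisor $d$ of $|G|$, the transiso graph $\Gamma_d(G)$ is the simple graph whose vertices are the subgroups of $G$ of order $d$, and in which two distinct vertices $H_1,H_2$ are adjacent if and only if there exist $S_i\in\mathcal{T}(G,H_i)$ $(i=1,2)$ with $S_1\cong S_2$. A graph is complete if any two distinct vertices are adjacent. *)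

(* Defs.v *)
From HB Require Import structures.
From mathcomp Require Import all_boot all_order all_algebra.
From mathcomp Require Import all_fingroup all_solvable.

Set Implicit Arguments.
Unset Strict Implicit.
Unset Printing Implicit Defensive.

Local Open Scope group_scope.

Definition p_central (gT : finGroupType) (p : nat) (G : {group gT}) : Prop :=
  forall H : {group gT}, H \subset G -> #|H| = p -> H \subset 'Z(G).

(* Normalized right transversals of H in G; [rcosets H G] is the set of the
   cosets [H :* x] with x in G, and it is a partition of G when H <= G. *)
Definition NRT (gT : finGroupType) (G H : {group gT}) : {set {set gT}} :=
  [set S : {set gT} | (1 \in S) && is_transversal S (rcosets H G) G].

(* If S is an NRT of H in G and x, y lie in S, then S :&: H :* (x * y) is a
   singleton, and [repr] returns its element. *)
Definition nrt_op (gT : finGroupType) (H : {group gT}) (S : {set gT})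
    (x y : gT) : gT :=
  repr (S :&: H :* (x * y)).

(* Only the restriction of f to S matters: it is a bijection from S onto T. *)
Definition nrt_isog (gT rT : finGroupType)
    (H : {group gT}) (S : {set gT}) (K : {group rT}) (T : {set rT}) : Prop :=
  exists f : gT -> rT,
    [/\ {in S &, injective f}, f @: S = T &
        {in S &, forall x y, f (nrt_op H S x y) = nrt_op K T (f x) (f y)}].

Definition transiso_vertices (gT : finGroupType) (d : nat) (G : {group gT}) :
    {set {group gT}} :=
  [set H : {group gT} | (H \subset G) && (#|H| == d)].

Definition transiso_adj (gT : finGroupType) (d : nat) (G : {group gT})
    (H1 H2 : {group gT}) : Prop :=
  [/\ H1 \in transiso_vertices d G, H2 \in transiso_vertices d G, H1 != H2 &
      exists S1 S2 : {set gT},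
        [/\ S1 \in NRT G H1, S2 \in NRT G H2 & nrt_isog H1 S1 H2 S2]].

Definition transiso_complete (gT : finGroupType) (d : nat) (G : {group gT}) :
    Prop :=
  {in transiso_vertices d G &, forall H1 H2 : {group gT},
     H1 != H2 -> transiso_adj d G H1 H2}.

(* Main.v *)
Require Import Defs.
From mathcomp Require Import all_boot all_order all_algebra.
From mathcomp Require Import all_fingroup all_solvable.

Local Open Scope group_scope.

(* A noncentral subgroup [H] of order [p] is core-free, so if a right
   transversal of [H] is associative as a right loop then it is a subgroup
   complementing [H]. Every transversal of a central [K] of order [p] is a copy
   of [G / K]; hence completeness gives [H] a complement [M], maximal in [G] and
   isomorphic to [G / K], and makes all the quotients [G / K] isomorphic.
   Comparing Frattini quotients, every such [K] lies in [Phi(G)]. Also no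
   noncentral [H] of order [p] lies in [Phi(G)], as [Phi(G) <= M].
   If [Phi(G)] were cyclic, then [Phi(M) = K], so [G / K = (H K / K) (M / K)]
   would have class at most 2 and be generated by elements of order [p]; as [p]
   is odd, [M] would have exponent [p], although it contains [Phi(G)].
   So [Phi(G)] is elementary abelian and central. If [|G'| = p], then [G / K] is
   abelian for [K = G'], hence for every [K <= Phi(G)] of order [p], which is
   absurd. Finally, if [Z(G)] strictly contained [Phi(G)], then we would
   have [|G : Z(G)| <= p^2], forcing [G'] to be cyclic. *)

(** * Normalized right transversals as right loops *)

Lemma setI_NRT_rcoset {gT : finGroupType} {G H : {group gT}} {S : {set gT}} g :
  H \subset G -> S \in NRT G H -> g \in G -> exists s, S :&: H :* g = [set s].
Proof.
move=> sHG; rewrite inE => /andP[_ trS] Gg.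
exists (transversal_repr 1 S (H :* g)).
by rewrite (setI_transversal_pblock trS 1) ?mem_rcosets // mulSGid.
Qed.

Lemma NRT_sub {gT : finGroupType} {G H : {group gT}} {S : {set gT}} :
  S \in NRT G H -> S \subset G.
Proof. by rewrite inE => /andP[_ /transversal_sub]. Qed.

Lemma NRT_rcoset_inj {gT : finGroupType} {G H : {group gT}} {S : {set gT}} :
  H \subset G -> S \in NRT G H ->
  {in S &, forall a b, a \in H :* b -> a = b}.
Proof.
move=> sHG tS a b Sa Sb Hab.
have Gb := subsetP (NRT_sub tS) b Sb.
have [s def_s] := setI_NRT_rcoset b sHG tS Gb.
have /set1P-> : a \in [set s] by rewrite -def_s inE Sa.
by apply/esym/set1P; rewrite -def_s inE Sb rcoset_refl.
Qed.

Lemma nrt_op_in {gT : finGroupType} {G H : {group gT}} {S : {set gT}} x y :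
  H \subset G -> S \in NRT G H -> x \in S -> y \in S ->
  nrt_op H S x y \in S :&: H :* (x * y).
Proof.
move=> sHG tS Sx Sy; have sSG := subsetP (NRT_sub tS).
have [s def_s] := setI_NRT_rcoset (x * y) sHG tS (groupM (sSG x Sx) (sSG y Sy)).
by rewrite /nrt_op def_s (mem_repr s) // set11.
Qed.

Lemma nrt_op_closed {gT : finGroupType} {G H : {group gT}} {S : {set gT}} :
  H \subset G -> S \in NRT G H -> {in S &, forall x y, nrt_op H S x y \in S}.
Proof.
by move=> sHG tS x y Sx Sy; case/setIP: (nrt_op_in x y sHG tS Sx Sy).
Qed.

(** * Transversals whose induced loop is a group *)

Lemma in_inj_cancel {aT rT : finGroupType} {S : {set aT}} {f : aT -> rT} :
  {in S &, injective f} -> exists g, {in S, cancel f g}.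
Proof.
move=> f_inj; exists (fun z => odflt 1 [pick x in S | f x == z]) => x Sx.
by case: pickP => [y /andP[Sy /eqP/f_inj->]|/(_ x)] //; rewrite Sx eqxx.
Qed.

(** Associativity of the loop on [S] is expressed by an isomorphism onto a genuine group [A], a form
    that can be carried along [nrt_isog]. *)
Definition nrt_group {gT aT : finGroupType} (H : {group gT}) (S : {set gT})
    (A : {group aT}) (f : gT -> aT) :=
  [/\ {in S &, injective f}, f @: S = A &
      {in S &, forall x y, f (nrt_op H S x y) = f x * f y}].

(** Each coset of the normal subgroup [K] is one point of [G / K] and meets [S] once; products agree
    since [nrt_op K S x y] stays in the coset of [x * y]. *)
Lemma nrt_group_quotient {gT : finGroupType} {G K : {group gT}} {S : {set gT}} :
  K <| G -> S \in NRT G K -> nrt_group K S (G / K) (coset K).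
Proof.
move=> nKG tS; have [sKG nKGs] := andP nKG; have sSG := subsetP (NRT_sub tS).
have sSN x (Sx : x \in S) : x \in 'N(K) by rewrite (subsetP nKGs) ?sSG.
split=> [x y Sx Sy /(rcoset_kercosetP (sSN x Sx) (sSN y Sy))||x y Sx Sy].
- exact: (NRT_rcoset_inj sKG tS).
- apply/eqP; rewrite eqEsubset; apply/andP; split.
    by apply/subsetP=> _ /imsetP[x Sx ->]; rewrite mem_quotient ?sSG.
  apply/subsetP=> _ /morphimP[g Ng Gg ->] /=.
  have [s def_s] := setI_NRT_rcoset g sKG tS Gg.
  have /setIP[Ss Kgs] : s \in S :&: K :* g by rewrite def_s set11.
  by apply/imsetP; exists s => //; apply/esym/rcoset_kercosetP; rewrite // sSN.
- have /setIP[Sxy Kxy] := nrt_op_in x y sKG tS Sx Sy.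
  by rewrite -morphM ?sSN //; apply/rcoset_kercosetP; rewrite ?groupM ?sSN.
Qed.

Lemma nrt_group_iso {gT rT aT : finGroupType} {H : {group gT}} {K : {group rT}}
    {S : {set gT}} {T : {set rT}} {A : {group aT}} {f : gT -> aT} :
  {in S &, forall x y, nrt_op H S x y \in S} ->
  nrt_isog H S K T -> nrt_group H S A f -> exists h, nrt_group K T A h.
Proof.
move=> opS [u [u_inj <- uM]] [f_inj fS fM].
have [v uK] := in_inj_cancel u_inj.
exists (f \o v); split=> [_ _ /imsetP[x Sx ->] /imsetP[y Sy ->]||].
- by rewrite /= !uK // => /f_inj->.
- by rewrite -fS -imset_comp; apply: eq_in_imset => x Sx /=; rewrite uK.
- move=> _ _ /imsetP[x Sx ->] /imsetP[y Sy ->] /=.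
  by rewrite -uM // !uK ?fM // opS.
Qed.

(** Both maps start from the same loop, so [g] after an inverse of [f] is multiplicative on [A]. *)
Lemma nrt_group_isog {gT aT bT : finGroupType} {H : {group gT}} {S : {set gT}}
    {A : {group aT}} {B : {group bT}} {f : gT -> aT} {g : gT -> bT} :
  {in S &, forall x y, nrt_op H S x y \in S} ->
  nrt_group H S A f -> nrt_group H S B g -> A \isog B.
Proof.
move=> opS [f_inj fS fM] [g_inj gS gM].
have [v fK] := in_inj_cancel f_inj.
have hM : {in A &, {morph g \o v : x y / x * y}}.
  rewrite -fS => _ _ /imsetP[x Sx ->] /imsetP[y Sy ->] /=.
  by rewrite -fM // !fK ?gM // opS.
apply: (isom_isog (Morphism hM)) => //; apply/isomP; split.
  apply/injmP=> a b /=.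
  rewrite -fS => /imsetP[x Sx ->] /imsetP[y Sy ->] /=.
  by rewrite !fK // => /g_inj->.
rewrite morphimEdom -gS /= -fS -imset_comp.
by apply: eq_in_imset => x Sx /=; rewrite fK.
Qed.

(* [G] acts faithfully on the right cosets of a core-free [H], and [y \in S]
   acts as right translation in the loop [S]; if [S] is associative these
   translations compose like elements of [S], so [S] itself is closed. *)
Lemma nrt_op_core_free {gT aT : finGroupType} {G H : {group gT}} {S : {set gT}}
    {A : {group aT}} {f : gT -> aT} :
  H \subset G -> gcore H G = 1 -> S \in NRT G H -> nrt_group H S A f ->
  {in S &, forall x y, nrt_op H S x y = x * y}.
Proof.
move=> sHG coreH tS [f_inj _ fM] x y Sx Sy.
have sSG := subsetP (NRT_sub tS).
have opS a b Sa Sb := nrt_op_in a b sHG tS Sa Sb.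
have clS := nrt_op_closed sHG tS.
have opE a b : a \in S -> b \in S -> H :* nrt_op H S a b = H :* (a * b).
  by move=> Sa Sb; apply/rcoset_eqP; have /setIP[] := opS a b Sa Sb.
have opA t : t \in S ->
    nrt_op H S t (nrt_op H S x y) = nrt_op H S (nrt_op H S t x) y.
  by move=> St; apply: f_inj; rewrite ?fM ?clS // ?fM ?mulgA ?clS.
have Sz := clS x y Sx Sy.
(* The discrepancy between the two products is shown to lie in every [G]-conjugate of [H], hence in
   the trivial core. *)
apply/eqP; rewrite eq_mulgV1 -in_set1 -[[set 1]]/(1 : {set gT}) -coreH.
apply/bigcapP=> g Gg; have [t def_t] := setI_NRT_rcoset g sHG tS Gg.
have /setIP[St Hgt] : t \in S :&: H :* g by rewrite def_t set11.
have -> : nrt_op H S x y * (x * y)^-1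
    = (g * nrt_op H S x y * (g * (x * y))^-1) ^ g.
  by rewrite conjgE !invMg !mulgA mulgKV mulVg mul1g.
rewrite memJ_conjg -mem_rcoset; apply/rcoset_eqP.
(* Replacing [g] by its representative [t] in [S] reduces the equality of cosets to [opA]. *)
rewrite !(rcosetM _ g) -(rcoset_eqP Hgt) -!rcosetM -opE // opA // opE ?clS //.
by rewrite [LHS]rcosetM opE // -rcosetM mulgA.
Qed.

(** * Group-theoretic consequences of adjacency *)

Lemma transiso_quotient_isog {gT : finGroupType} {d : nat}
    {G K1 K2 : {group gT}} :
  K1 <| G -> K2 <| G -> transiso_adj d G K1 K2 -> G / K1 \isog G / K2.
Proof.
move=> nK1 nK2 [_ _ _ [S1 [S2 [tS1 tS2 iS]]]].
have opS1 := nrt_op_closed (normal_sub nK1) tS1.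
have opS2 := nrt_op_closed (normal_sub nK2) tS2.
have [h hS2] := nrt_group_iso opS1 iS (nrt_group_quotient nK1 tS1).
exact: nrt_group_isog opS2 hS2 (nrt_group_quotient nK2 tS2).
Qed.

(** The complement is the transversal of [H] itself: its loop is a copy of [G / K], so core-freeness
    makes it a subgroup. *)
Lemma transiso_complement {gT : finGroupType} {d : nat} {G K H : {group gT}} :
  K <| G -> gcore H G = 1 -> transiso_adj d G K H ->
  exists M : {group gT}, [/\ M \subset G, H :&: M = 1, H * M = G
                           & G / K \isog M].
Proof.
move=> nK coreH [_]; rewrite inE => /andP[sHG _] _ [S1 [S2 [tS1 tS2 iS]]].
have opS1 := nrt_op_closed (normal_sub nK) tS1.
have opS2 := nrt_op_closed sHG tS2.
have [h hS2] := nrt_group_iso opS1 iS (nrt_group_quotient nK tS1).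
have opE := nrt_op_core_free sHG coreH tS2 hS2.
have S2_1 : 1 \in S2 by move: tS2; rewrite inE => /andP[].
have gS2 : group_set S2.
  by apply/group_setP; split=> // x y Sx Sy; rewrite -opE ?opS2.
exists (Group gS2); split; first exact: NRT_sub tS2.
- apply/trivgP/subsetP=> x /setIP[Hx Sx]; apply/set1P.
  by apply: (NRT_rcoset_inj sHG tS2); rewrite // mulg1.
- apply/eqP; rewrite eqEsubset mul_subG ?(NRT_sub tS2) //=.
  apply/subsetP=> g Gg; have [s def_s] := setI_NRT_rcoset g sHG tS2 Gg.
  have /setIP[Ss] : s \in S2 :&: H :* g by rewrite def_s set11.
  by rewrite rcoset_sym => /rcosetP[k Hk ->]; rewrite mem_mulg.
- apply: nrt_group_isog opS2 hS2 (_ : nrt_group H S2 (Group gS2) id).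
  by split=> [x y||x y] //; [rewrite imset_id | apply: opE].
Qed.

(** * Auxiliary facts on finite p-groups *)

Lemma der1_sub_Phi {gT : finGroupType} {p : nat} {G : {group gT}} :
  p.-group G -> G^`(1) \subset 'Phi(G).
Proof. by move=> pG; rewrite (Phi_joing pG) joing_subl. Qed.

Lemma normal_prime_sub_center {gT : finGroupType} {p : nat} {G H : {group gT}} :
  p.-group G -> H <| G -> prime #|H| -> H \subset 'Z(G).
Proof.
move=> pG nHG prH; apply: prime_meetG => //.
by rewrite meet_center_nil ?(pgroup_nil pG) // -cardG_gt1 prime_gt1.
Qed.

(** The core is [1] or [H]; in the latter case [H] is normal of prime order, hence central. *)
Lemma gcore_prime_eq1 {gT : finGroupType} {p : nat} {G H : {group gT}} :
  p.-group G -> H \subset G -> prime #|H| -> ~~ (H \subset 'Z(G)) ->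
  gcore H G = 1.
Proof.
move=> pG sHG prH; apply: contraNeq => core_neq1.
have def_core : gcore H G = H.
  apply/eqP; rewrite eqEsubset gcore_sub; apply: prime_meetG => //.
  by rewrite (setIidPr (gcore_sub H G)).
by apply: (normal_prime_sub_center pG); rewrite // -def_core gcore_normal.
Qed.

(* [G] is generated by ['Z(G)] and two elements [x], [y], so [G^`(1)] is
   generated by [[~ x, y]]. *)
Lemma cyclic_der1_of_large_center {gT : finGroupType} {p : nat}
    {G : {group gT}} :
  p.-group G -> G^`(1) \subset 'Z(G) ->
  logn p #|G| <= (logn p #|'Z(G)|).+2 -> cyclic G^`(1).
Proof.
move=> pG sG'Z le_log; have sZG := center_sub G.
have [abG|/subsetPn[x Gx Z'x]] := boolP (G \subset 'Z(G)).
  by rewrite (derG1P (subset_trans abG (subsetIr G 'C(G)))) cyclic1.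
have sXG : <[x]> \subset G by rewrite cycle_subG.
pose A := 'Z(G) <*> <[x]>; have sAG : A \subset G by rewrite join_subG sZG.
have ltZA : 'Z(G) \proper A.
  rewrite properE joing_subl; apply: contra Z'x; rewrite join_subG => /andP[_].
  by rewrite cycle_subG.
have abA : abelian A.
  rewrite abelianY center_abelian cycle_abelian /=.
  by rewrite (subset_trans sXG) // centsC subsetIr.
have [sGA|/subsetPn[y Gy A'y]] := boolP (G \subset A).
  by rewrite (derG1P (abelianS sGA abA)) cyclic1.
have sYG : <[y]> \subset G by rewrite cycle_subG.
have ltAB : A \proper A <*> <[y]>.
  rewrite properE joing_subl; apply: contra A'y; rewrite join_subG => /andP[_].
  by rewrite cycle_subG.
(* Otherwise ['Z(G)], [A], [A <*> <[y]>], [G] is a chain with three strict inclusions, against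
   [le_log]. *)
have defG : 'Z(G) <*> (<[x]> <*> <[y]>) = G.
  rewrite joingA; apply/eqP; apply: contraTT le_log => neqG.
  have ltBG : A <*> <[y]> \proper G.
    by rewrite properEneq neqG join_subG sAG.
  rewrite -ltnNge; apply: leq_trans _ (properG_ltn_log pG ltBG).
  have pB := pgroupS (proper_sub ltBG) pG.
  rewrite ltnS; apply: leq_trans _ (properG_ltn_log pB ltAB).
  by rewrite ltnS; apply: properG_ltn_log (pgroupS sAG pG) ltZA.
have sXYG : <[x]> <*> <[y]> \subset G by rewrite join_subG sXG.
have cZXY : <[x]> <*> <[y]> \subset 'C('Z(G)).
  by rewrite (subset_trans sXYG) // centsC subsetIr.
have /(der_cprod 1) : 'Z(G) \* (<[x]> <*> <[y]>) = G.
  by rewrite cprodEY.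
rewrite (derG1P (center_abelian G)) cprod1g => <-.
rewrite der1_joing_cycles ?cycle_cyclic //.
apply: subsetP (mem_commg Gx Gy); apply: subset_trans sG'Z _.
by rewrite (subset_trans (subsetIr G 'C(G))) // centS.
Qed.

(** * Structure of the Frattini subgroup *)

Lemma exists_central_subgroup_Phi {gT : finGroupType} {p : nat}
    {G : {group gT}} :
  p.-group G -> 'Phi(G) != 1 -> exists K : {group gT},
    [/\ K \subset 'Phi(G), K \subset 'Z(G) & #|K| = p].
Proof.
move=> pG ntPhi.
have ntPZ : 'Phi(G) :&: 'Z(G) != 1.
  by apply: meet_center_nil; rewrite ?(pgroup_nil pG) ?Phi_normal.
have sPZ : 'Phi(G) :&: 'Z(G) \subset G by rewrite subIset ?Phi_sub.
have [p_pr p_dvd _] := pgroup_pdiv (pgroupS sPZ pG) ntPZ.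
have [x /setIP[Px Zx] ox] := Cauchy p_pr p_dvd.
by exists <[x]>%G; rewrite !cycle_subG.
Qed.

Lemma central_normal {gT : finGroupType} {G K : {group gT}} :
  K \subset 'Z(G) -> K <| G.
Proof. by move=> ?; rewrite sub_center_normal. Qed.

(** If [K] is not in ['Phi(G)], it meets it trivially and ['Phi(G / K)] keeps the order of
    ['Phi(G)]; a central [L] of order [p] inside ['Phi(G)] makes that order drop. *)
Lemma central_prime_sub_Phi {gT : finGroupType} {p : nat} {G : {group gT}} :
  p.-group G -> 'Phi(G) != 1 ->
  (forall K1 K2 : {group gT}, K1 \subset 'Z(G) -> #|K1| = p ->
     K2 \subset 'Z(G) -> #|K2| = p -> G / K1 \isog G / K2) ->
  forall K : {group gT}, K \subset 'Z(G) -> #|K| = p -> K \subset 'Phi(G).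
Proof.
move=> pG ntPhi iso K cK oK.
have [p_pr _ _] := pgroup_pdiv (pgroupS (Phi_sub G) pG) ntPhi.
have [L [sLPhi cL oL]] := exists_central_subgroup_Phi pG ntPhi.
have nN (X : {group gT}) : X \subset 'Z(G) -> G \subset 'N(X).
  by move=> cX; rewrite normal_norm ?central_normal.
apply: contraTT (ltn_quotient (_ : L :!=: 1) sLPhi); last first.
  by rewrite -cardG_gt1 oL prime_gt1.
move=> K'Phi; rewrite -leqNgt.
have /card_isog <- : 'Phi(G) / K \isog 'Phi(G) / L.
  rewrite (quotient_Phi pG (nN K cK)) (quotient_Phi pG (nN L cL)).
  exact: gFisog (iso K L cK oK cL oL).
rewrite -(card_isog (quotient_isog _ _)) //.
  by rewrite (subset_trans (Phi_sub G)) ?nN.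
by rewrite prime_TIg // oK.
Qed.

Lemma Phi_noncyclic {gT : finGroupType} {p : nat} {G K H M : {group gT}} :
  prime p -> odd p -> p.-group G -> #|'Phi(G)| = (p ^ 2)%N ->
  (forall L : {group gT}, L \subset 'Z(G) -> #|L| = p -> L \subset 'Phi(G)) ->
  K \subset 'Z(G) -> #|K| = p -> #|H| = p -> H * M = G -> maximal M G ->
  G / K \isog M -> ~~ cyclic 'Phi(G).
Proof.
move=> p_pr odd_p pG oPhi sub_Phi cK oK oH defG maxM isoM; apply/negP=> cycPhi.
have nMG := p_maximal_normal pG maxM; have sMG := normal_sub nMG.
have sHG : H \subset G by rewrite -defG mulG_subl.
have nKG := normal_norm (central_normal cK).
have sKPhi := sub_Phi K cK oK.
have oPhiGK : #|'Phi(G / K)| = p.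
  rewrite -(quotient_Phi pG nKG) card_quotient ?(subset_trans (Phi_sub G)) //.
  by rewrite -divgS // oPhi oK -mulnn mulnK ?prime_gt0.
have oPhiM : #|'Phi(M)| = p.
  by rewrite -oPhiGK; apply/esym/card_isog/(gFisog _ isoM).
have cPhiM : 'Phi(M) \subset 'Z(G).
  rewrite (normal_prime_sub_center pG) ?oPhiM //.
  exact: char_normal_trans (Phi_char M) nMG.
(* Both have order [p] in the cyclic group ['Phi(G)], which has only one such subgroup. *)
have defPhiM : 'Phi(M) = K.
  apply/eqP; rewrite (eq_subG_cyclic cycPhi) ?oPhiM ?oK //.
  exact: sub_Phi cPhiM oPhiM.
have abelMK : p.-abelem (M / K).
  by rewrite -defPhiM Phi_quotient_abelem ?(pgroupS sMG).
have abelHK : p.-abelem (H / K) by rewrite quotient_abelem ?prime_abelem.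
have pGK : p.-group (G / K) by rewrite quotient_pgroup.
(* [G / K] is the product of the elementary abelian images of [H] and [M]. *)
have Ohm_GK : 'Ohm_1(G / K) = G / K.
  have sub_Ohm (X : {group gT}) :
      X \subset G -> p.-abelem (X / K) -> X / K \subset 'Ohm_1(G / K).
    move=> sXG abelX; rewrite -(Ohm1_id abelX).
    exact: OhmS (quotientS K sXG).
  apply/eqP; rewrite eqEsubset Ohm_sub /= -{1}defG.
  by rewrite quotientMl ?(subset_trans sHG) // mul_subG ?sub_Ohm.
(* The class is at most 2 because ['Phi(G / K)], of order [p], is central; oddness of [p] then
   bounds the exponent of ['Ohm_1]. *)
have expGK : exponent (G / K) %| p.
  rewrite -Ohm_GK exponent_Ohm1_class2 // nil_class2.
  apply: subset_trans (der1_sub_Phi pGK) _.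
  by rewrite (normal_prime_sub_center pGK) ?Phi_normal ?oPhiGK.
have : exponent 'Phi(G) %| p.
  apply: dvdn_trans (exponentS (Phi_sub_max maxM)) _.
  by rewrite -(exponent_isog isoM).
by rewrite exponent_cyclic // oPhi -{2}[p]expn1 dvdn_Pexp2l ?(prime_gt1 p_pr).
Qed.

Lemma noncyclic_order_p2 {gT : finGroupType} {p : nat} {A : {group gT}}
    {x : gT} :
  prime p -> #|A| = (p ^ 2)%N -> ~~ cyclic A -> x \in A -> x != 1 -> #[x] = p.
Proof.
move=> p_pr oA ncycA Ax ntx.
have : #[x] %| (p ^ 2)%N by rewrite -oA order_dvdG.
case/(dvdn_pfactor _ _ p_pr) => [[|[|[|n]]]] // _ ox.
  by rewrite -order_eq1 ox in ntx.
case/negP: ncycA; apply/cyclicP; exists x; apply/esym/eqP.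
by rewrite eqEcard cycle_subG Ax oA -ox /=.
Qed.

Lemma Phi_eq_der1_eq_center {gT : finGroupType} {p : nat} {G : {group gT}} :
  prime p -> p.-group G -> #|G| = (p ^ 5)%N -> ~~ abelian G ->
  #|'Phi(G)| = (p ^ 2)%N -> ~~ cyclic 'Phi(G) -> 'Phi(G) \subset 'Z(G) ->
  (forall K L : {group gT}, K \subset 'Z(G) -> #|K| = p ->
     L \subset 'Z(G) -> #|L| = p -> G / K \isog G / L) ->
  [/\ 'Phi(G) = G^`(1), G^`(1) = 'Z(G) & p.-abelem 'Z(G)].
Proof.
move=> p_pr pG oG nabG oPhi ncycPhi cPhi iso.
have prime_of_Phi x : x \in 'Phi(G) -> x != 1 -> #[x] = p.
  exact: (noncyclic_order_p2 p_pr oPhi ncycPhi).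
have abelPhi : p.-abelem 'Phi(G).
  apply/abelemP=> //; split; first exact: card_p2group_abelian oPhi.
  move=> x Px; have [->|ntx] := eqVneq x 1; first by rewrite expg1n.
  by rewrite -(prime_of_Phi x Px ntx) expg_order.
have sG'Phi := der1_sub_Phi pG.
have defG' : 'Phi(G) = G^`(1).
  apply/eqP; rewrite eq_sym; apply: contraR nabG => neqG'.
  have ltG' : G^`(1) \proper 'Phi(G) by rewrite properEneq neqG'.
  (* The subgroup [<[x]>] will be a second central subgroup of order [p], to compare with the
     commutator subgroup. *)
  have [_ [x Px G'x]] := properP ltG'.
  apply: contraR (G'x) => nabG; rewrite -cycle_subG.
  have ntG' : G^`(1) != 1 by apply: contra nabG => /eqP/derG1P.
  have [m oG'] : exists m, #|G^`(1)| = (p ^ m.+1)%N.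
    by have [] := pgroup_pdiv (pgroupS (der_sub 1 G) pG) ntG'.
  have {m}oG' : #|G^`(1)| = p.
    have : (#|G^`(1)| < p ^ 2)%N by rewrite -oPhi proper_card.
    by rewrite oG' ltn_exp2l ?prime_gt1 //; case: m {oG'} => // _.
  have ox : #|<[x]>| = p.
    by apply: prime_of_Phi => //; apply: contraNneq G'x => ->.
  have cX : <[x]> \subset 'Z(G) by rewrite cycle_subG (subsetP cPhi).
  have cG' := subset_trans sG'Phi cPhi.
  have abG : abelian (G / G^`(1)) by apply: sub_der1_abelian.
  (* Now [G / <[x]>] is abelian too, so [<[x]>] contains the commutator subgroup and equals it by
     order, contradicting the choice of [x]. *)
  rewrite (isog_abelian (iso _ _ cG' oG' cX ox)) in abG.
  have nXG : G \subset 'N(<[x]>) by rewrite normal_norm ?central_normal.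
  have /eqP <- : G^`(1) == <[x]> by rewrite eqEcard der1_min // ox oG' leqnn.
  exact: subxx.
have defZ : 'Phi(G) = 'Z(G).
  (* A larger center would have order at least [p ^ 3], hence index at most [p ^ 2]. *)
  apply/eqP; apply: contraR ncycPhi => neqZ; rewrite defG'.
  apply: (cyclic_der1_of_large_center pG); first by rewrite -defG'.
  have ltZ : 'Phi(G) \proper 'Z(G) by rewrite properEneq neqZ.
  have := properG_ltn_log (pgroupS (center_sub G) pG) ltZ.
  by rewrite oPhi oG !pfactorK.
by rewrite -defG' -defZ.
Qed.

Lemma setX_Zp_abelem {p : nat} : prime p -> p.-abelem (setX (Zp p) (Zp p)).
Proof.
move=> p_pr.
have abelZ : p.-abelem (Zp p) by rewrite prime_abelem ?card_Zp ?prime_gt0.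
rewrite (dprod_abelem _ (setX_dprod (Zp_group p) (Zp_group p))).
rewrite -(isog_abelem (isog_setX1 _ _)) -(isog_abelem (isog_set1X _ _)).
by rewrite abelZ.
Qed.

Theorem proposition3p14 (gT : finGroupType) (G : {group gT}) (p : nat)
    (p_prime : prime p) (p_odd : odd p)
    (cardG : #|G| = (p ^ 5)%N)
    (not_central : ~ p_central p G)
    (cardPhi : #|'Phi(G)| = (p ^ 2)%N) :
  transiso_complete p G ->
  [/\ 'Phi(G) = G^`(1), G^`(1) = 'Z(G) & 'Z(G) \isog setX (Zp p) (Zp p)].
Proof.
move=> complete.
have pG : p.-group G by rewrite /pgroup cardG pnatX pnat_id.
have ntPhi : 'Phi(G) != 1.
  by rewrite trivg_card1 cardPhi -(expn0 p) eqn_exp2l ?prime_gt1.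
have adj (X Y : {group gT}) : X \subset G -> #|X| = p -> Y \subset G ->
    #|Y| = p -> X != Y -> transiso_adj p G X Y.
  by move=> sXG oX sYG oY; apply: complete; rewrite inE ?sXG ?sYG ?oX ?oY /=.
have sZG := subset_trans _ (center_sub G).
have iso (K L : {group gT}) : K \subset 'Z(G) -> #|K| = p ->
    L \subset 'Z(G) -> #|L| = p -> G / K \isog G / L.
  move=> cK oK cL oL; have [->|neqKL] := eqVneq K L; first exact: isog_refl.
  exact: transiso_quotient_isog (central_normal cK) (central_normal cL)
    (adj K L (sZG _ cK) oK (sZG _ cL) oL neqKL).
have compl (K H : {group gT}) : K \subset 'Z(G) -> #|K| = p ->
    H \subset G -> #|H| = p -> ~~ (H \subset 'Z(G)) ->
    exists M : {group gT}, [/\ maximal M G, H :&: M = 1, H * M = G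
                             & G / K \isog M].
  move=> cK oK sHG oH ncH.
  have neqKH : K != H by apply: contraNneq ncH => <-.
  have coreH : gcore H G = 1 by rewrite (gcore_prime_eq1 pG) ?oH.
  have [M [sMG tiHM defG isoM]] := transiso_complement (central_normal cK) coreH
    (adj K H (sZG _ cK) oK sHG oH neqKH).
  (* The index of [M] is the order of [H], namely [p]. *)
  exists M; split=> //; apply: p_index_maximal => //.
  by rewrite -divgS // -defG TI_cardMg // oH mulnK.
have [K [_ cK oK]] := exists_central_subgroup_Phi pG ntPhi.
have sub_Phi := central_prime_sub_Phi pG ntPhi iso.
have [H /and3P[sHG /eqP oH ncH]] : exists H : {group gT},
    [&& H \subset G, #|H| == p & ~~ (H \subset 'Z(G))].
  apply/existsP; apply: contra_notT not_central => /existsPn no_H H sHG oH.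
  by have := no_H H; rewrite sHG oH eqxx negbK.
have [M [maxM _ defG isoM]] := compl K H cK oK sHG oH ncH.
have ncycPhi :=
  Phi_noncyclic p_prime p_odd pG cardPhi sub_Phi cK oK oH defG maxM isoM.
have cPhi : 'Phi(G) \subset 'Z(G).
  apply/subsetP=> x Px; have [->|ntx] := eqVneq x 1; first exact: group1.
  have ox : #[x] = p := noncyclic_order_p2 p_prime cardPhi ncycPhi Px ntx.
  rewrite -cycle_subG; apply/negPn/negP=> ncX.
  have sXG : <[x]> \subset G by rewrite cycle_subG (subsetP (Phi_sub G)).
  have [N [maxN tiXN _ _]] := compl K <[x]>%G cK oK sXG ox ncX.
  case/eqP: ntx; apply/set1P; rewrite -[[set 1]]/(1 : {set gT}) -tiXN.
  rewrite inE cycle_id.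
  exact: subsetP (Phi_sub_max maxN) x Px.
have nabG : ~~ abelian G.
  by apply: contra ncH => abG; rewrite (subset_trans sHG) // subsetI subxx.
have [defG' defZ abelZ] :=
  Phi_eq_der1_eq_center p_prime pG cardG nabG cardPhi ncycPhi cPhi iso.
(* Elementary abelian p-groups of equal order are isomorphic; here both orders are [p ^ 2]. *)
split=> //; rewrite (isog_abelem_card (setX_group _ _) abelZ).
by rewrite setX_Zp_abelem //= cardsX card_Zp ?prime_gt0 // -defZ -defG' cardPhi.
Qed.
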